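(* Let $f:\mathbb{R}^d\to\mathbb{R}$ be a convex differentiable function for which the matrix $\mathbf{A}\in\mathbb{R}^{n\times d}$ satisfies $$f(x+h)\le f(x)+(f'(x))^\top h+\tfrac12 h^\top \mathbf{A}^\top\mathbf{A}h\qquad\text{for all }x,h\in\mathbb{R}^d,$$ and let $\hat S$ be the distributed sampling with parameters $c,s,\tau$ associated with the partition $\{\mathcal{P}_1,\dots,\mathcal{P}_c\}$ of $\{1,\dots,d\}$. For $j=1,\dots,n$ let $$\alpha_j^*:=\alpha_{1,j}^*+\alpha_{2,j}^*,\qquad \alpha_{1,j}^*=1+\frac{(\tau-1)(\omega_j-1)}{s_1},\qquad \alpha_{2,j}^*=\Big(\frac{\tau}{s}-\frac{\tau-1}{s_1}\Big)\frac{\omega_j'-1}{\omega_j'}\,\omega_j .$$ Then the ESO (Expected Separable Overapproximation) assumption is satisfied with $$\mathbf{D}_{ii}=\sum_{j=1}^n\alpha_j^*\mathbf{A}_{ji}^2,\qquad i=1,\dots,d;$$ that is, with $\mathbf{D}$ the diagonal matrix having these (positive) diagonal elements, for all $x,h\in\mathbb{R}^d$, $$\mathbb{E}\big[f(x+h^{\hat S})\big]\le f(x)+\frac{\mathbb{E}[|\hat S|]}{d}\Big((f'(x))^\top h+\tfrac12 h^\top\mathbf{D}h\Big).$$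
   Context: $\mathbf{A}$ is an $n\times d$ real matrix with no zero row and no zero column. The set $\{1,\dots,d\}$ is partitioned into $c$ sets $\mathcal{P}_1,\dots,\mathcal{P}_c$, each of size $s=d/c$. An integer $\tau$ with $1\le\tau\le s$ is fixed, and $s_1:=\max\{1,s-1\}$. Distributed sampling: for each $l\in\{1,\dots,c\}$, $\hat S_l$ is a subset of $\mathcal{P}_l$ of cardinality $\tau$ chosen uniformly at random, independently across $l$; $\hat S:=\bigcup_{l=1}^c\hat S_l$. For $h\in\mathbb{R}^d$, $h^{\hat S}:=\sum_{i\in\hat S}h^ie_i$, where $h^i$ is the $i$-th coordinate of $h$ and $e_i$ is the $i$-th unit coordinate vector. $f'(x)$ denotes the gradient of $f$ at $x$. $\omega_j$ is the number of nonzeros in the $j$-th row of $\mathbf{A}$, and $\omega_j'$ is the number of indices $l\in\{1,\dots,c\}$ for which the set $\{i\in\mathcal{P}_l:\mathbf{A}_{ji}\neq0\}$ is nonempty. *)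

(* Defs.v *)
From mathcomp Require Export all_boot all_order all_algebra.
From mathcomp Require Export all_classical all_reals all_analysis.
Export numFieldNormedType.Exports.
Import Order.TTheory GRing.Theory Num.Theory.

Set Implicit Arguments.
Unset Strict Implicit.
Unset Printing Implicit Defensive.

Local Open Scope ring_scope.

Definition gradient (R : realType) (d : nat) (f : 'cV[R]_d -> R)
    (x : 'cV[R]_d) : 'cV[R]_d :=
  \col_i 'D_(delta_mx i 0) f x.

Definition restrict_coord (R : realType) (d : nat) (h : 'cV[R]_d)
    (S : {set 'I_d}) : 'cV[R]_d :=
  \sum_(i in S) h i 0 *: delta_mx i 0.

Definition convex_differentiable (R : realType) (d : nat)
    (f : 'cV[R]_d -> R) : Prop :=
  @convex_function R 'cV[R]_d setT f /\ forall x, differentiable f x.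

Definition quadratic_upper_bound (R : realType) (n d : nat)
    (f : 'cV[R]_d -> R) (A : 'M[R]_(n, d)) : Prop :=
  forall x h : 'cV[R]_d,
    f (x + h) <= f x + ((gradient f x)^T *m h) 0 0
                 + 2^-1 * (h^T *m A^T *m A *m h) 0 0.

(* [classical_sets] also exports a [partition], hence the qualified name.
   Injectivity of [Q] makes the [c] blocks distinct. *)
Definition equipartition (d c s : nat) (Q : 'I_c -> {set 'I_d}) : Prop :=
  [/\ injective Q,
      finset.partition (Q @: 'I_c)%SET [set: 'I_d]%SET
    & forall l, #|Q l| = s].

Section Sampling.
Context (R : realType) (dsp : measure_display) (T : measurableType dsp)
  (P : probability T R).

(* Singletons suffice for measurability, because [U] is finite. *)
Definition random_element (U : finType) (X : T -> U) : Prop :=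
  forall u : U, measurable (X @^-1` [set u])%classic.

Definition uniform_on (U : finType) (X : T -> U) (F : {set U}) : Prop :=
  forall u : U,
    P (X @^-1` [set u])%classic = (if u \in F then #|F|%:R^-1 else 0)%:E.

Definition mutually_independent (I U : finType) (X : I -> T -> U) : Prop :=
  forall (J : {set I}) (B : I -> set U),
    P (\bigcap_(l in [set` J]) (X l @^-1` B l))%classic
    = (\prod_(l in J) P (X l @^-1` B l)%classic)%E.

Definition distributed_sampling (d c tau : nat) (Q : 'I_c -> {set 'I_d})
    (Shat : T -> {set 'I_d}) : Prop :=
  exists S : 'I_c -> T -> {set 'I_d},
    [/\ forall l, random_element (S l),
        forall l, uniform_on (S l) [set B in powerset (Q l) | #|B| == tau]%SET,
        mutually_independent S
      & forall w, Shat w = (\bigcup_(l < c) S l w)%SET].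

Definition ESO (d : nat) (f : 'cV[R]_d -> R) (Shat : T -> {set 'I_d})
    (D : 'M[R]_d) : Prop :=
  [/\ is_diag_mx D,
      forall i, 0 < D i i
    & forall x h : 'cV[R]_d,
        ('E_P[fun w => f (x + restrict_coord h (Shat w))%R]
         <= (f x)%:E
            + ('E_P[fun w => #|Shat w|%:R%R] * (d%:R^-1)%:E)
              * (((gradient f x)^T *m h) 0 0
                 + 2^-1 * (h^T *m D *m h) 0 0)%R%:E)%E].

End Sampling.

Section Alpha.
Context (R : realType) (n d c : nat) (s tau : nat) (A : 'M[R]_(n, d))
  (Q : 'I_c -> {set 'I_d}).

Definition s1 : nat := maxn 1 (s - 1).

Definition omega (j : 'I_n) : nat := #|[pred i : 'I_d | A j i != 0]|.

Definition omega' (j : 'I_n) : nat :=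
  #|[pred l : 'I_c | [set i in Q l | A j i != 0]%SET != finset.set0]|.

Definition alpha1 (j : 'I_n) : R :=
  1 + (tau%:R - 1) * ((omega j)%:R - 1) / s1%:R.

Definition alpha2 (j : 'I_n) : R :=
  (tau%:R / s%:R - (tau%:R - 1) / s1%:R)
  * (((omega' j)%:R - 1) / (omega' j)%:R) * (omega j)%:R.

Definition alpha (j : 'I_n) : R := alpha1 j + alpha2 j.

Definition eso_matrix : 'M[R]_d :=
  diag_mx (\row_i \sum_(j < n) alpha j * A j i ^+ 2).

End Alpha.

(* Main.v *)
Require Import Defs.
From mathcomp Require Import ring.
Import Order.TTheory GRing.Theory Num.Theory.

Set Implicit Arguments.
Unset Strict Implicit.
Unset Printing Implicit Defensive.

Local Open Scope ring_scope.

(** The argument is a second moment computation.  The quadratic upper bound,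
    applied at the increment [restrict_coord h (Shat w)], reads
      f (x + h^S) <= f x + sum_(i in S) g_i h_i
                     + 1/2 sum_j (sum_(i in S) a_i)^2,   a_i = A_ji h_i,
    so everything reduces to the first two moments of the random sums
    [sum_(i in S) a_i].

    The family of block samples takes finitely many values and, by
    independence, has a product law ([prod_weight]), so every expectation is a finite
    weighted sum ([expectation_distributed]) and the rest is algebra.

    Each coordinate is sampled with probability p = tau/s, so the mean of the
    sum is p sum_i a_i ([sampling_mean_sum]); taking a = 1 shows that
    E|S| = p d.  Two distinct coordinates are sampled together with
    probability p beta, beta = (tau-1)/s1, inside one block, and p^2 across
    blocks.  With b_l the sum of a over block l this gives
    ([sampling_mean_sqr])
      E (sum_(i in S) a_i)^2
        = p ((1-beta) sum a_i^2 + beta (sum a_i)^2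
             + (p-beta) ((sum a_i)^2 - sum b_l^2)).
    Both beta and p - beta are nonnegative ([draw_gap_ge0]), so it remains to
    bound the two squares, by Cauchy-Schwarz restricted to the support
    ([sqr_sum_le_card]): at most omega_j of the a_i are nonzero, whence
    (sum a_i)^2 <= omega_j sum a_i^2; at most omega'_j of the b_l are nonzero,
    whence sum b_l^2 >= (sum a_i)^2 / omega'_j.  The resulting factor of
    sum a_i^2 is exactly alpha_j ([sampling_row_mean_sqr]).

    The diagonal entries are positive because every alpha_j is ([alpha_gt0])
    and no column of the matrix vanishes. *)

(** * Counting the draws of [k] elements *)

Definition draws (T : finType) (A : {set T}) (k : nat) : {set {set T}} :=
  [set B in powerset A | #|B| == k]%SET.

Lemma card_draws_set (T : finType) (A : {set T}) k :
  #|draws A k| = 'C(#|A|, k).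
Proof.
by rewrite -cards_draws; apply: eq_card => B; rewrite !inE.
Qed.

(** Both sides count the pairs made of an [m]-subset of an [n]-set and an
    injective [r]-word in it. *)
Lemma bin_ffact_sub n m r :
  (r <= m)%N -> (n ^_ r * 'C(n - r, m - r) = 'C(n, m) * m ^_ r)%N.
Proof.
elim: r n m => [|r IHr] n m; first by rewrite !ffactn0 !subn0 mul1n muln1.
case: m => // m; case: n => [|n] lerm; first by rewrite bin0n.
rewrite !ffactSS !subSS -mulnA IHr // mulnA.
by have /= -> := mul_bin_diag n.+1 m; rewrite (mulnC m.+1) mulnA.
Qed.

(** Removing [J] turns the draws that contain [J] into the draws of [k - #|J|]
    elements of [A :\: J].  The product form with falling factorials also covers
    [k < #|J|], where both sides vanish. *)
Lemma card_draws_superset (T : finType) (A J : {set T}) k :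
  J \subset A ->
  (#|A| ^_ #|J| * #|[set B in draws A k | J \subset B]%SET|
   = 'C(#|A|, k) * k ^_ #|J|)%N.
Proof.
move=> JA; case: (leqP #|J| k) => [leJk|ltkJ]; last first.
  rewrite (ffact_small ltkJ) muln0 (_ : [set _ in _ | _]%SET = finset.set0).
    by rewrite cards0 muln0.
  apply/setP=> B; rewrite !inE; apply/negP => /andP[/andP[_ /eqP Bk] JB].
  by move: ltkJ; rewrite -Bk ltnNge subset_leq_card.
rewrite -bin_ffact_sub //; congr (_ * _)%N.
rewrite -cardsDS // -cards_draws.
rewrite -(card_in_imset (f := fun B => (B :|: J)%SET)); last first.
  move=> B C; rewrite !inE => /andP[BA _] /andP[CA _] /= eqBC.
  have dis (X : {set T}) : X \subset (A :\: J)%SET -> ((X :|: J) :\: J = X)%SET.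
    move=> /fintype.subsetP sX; apply/setP=> x; rewrite !inE.
    case: (boolP (x \in X)) => [/sX|_]; last by case: (x \in J).
    by rewrite inE => /andP[->].
  by rewrite -(dis _ BA) eqBC dis.
apply: eq_card => B; rewrite !inE.
apply/idP/imsetP => [/andP[/andP[BA /eqP Bk] JB]|[C + ->]].
  exists (B :\: J)%SET; last first.
    apply/setP => x; rewrite !inE.
    by case: (boolP (x \in J)) => [/(fintype.subsetP JB) ->|_]; rewrite ?orbF.
  by rewrite inE finset.setSD //= cardsDS // Bk.
rewrite inE finset.subsetD => /andP[/andP[CA dCJ] /eqP Ck].
rewrite finset.subUset CA JA finset.subsetUr cardsU (disjoint_setI0 dCJ).
by rewrite cards0 subn0 Ck subnK ?eqxx.
Qed.

(** * Squares of finite sums *)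

Lemma sum_sqr_pairs (R : comPzRingType) (I : finType) (F : pred I)
    (a : I -> R) :
  (\sum_(i | F i) a i) ^+ 2
  = \sum_(i | F i) a i ^+ 2
    + \sum_(i | F i) \sum_(k | F k && (k != i)) a i * a k.
Proof.
rewrite expr2 mulr_suml -big_split; apply: eq_bigr => i iA /=.
by rewrite mulr_sumr (bigD1 i) //= expr2.
Qed.

(** Cauchy-Schwarz against the indicator of [F], from the nonnegativity of the
    sum of all [(a i - a k) ^+ 2]. *)
Lemma sqr_sum_le_card (R : realDomainType) (I : finType) (F : pred I)
    (a : I -> R) :
  (forall i, ~~ F i -> a i = 0) ->
  (\sum_i a i) ^+ 2 <= #|F|%:R * \sum_i a i ^+ 2.
Proof.
move=> aF.
have E (b : I -> R) : (forall i, ~~ F i -> b i = 0) ->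
    \sum_i b i = \sum_(i | F i) b i.
  move=> bF; rewrite [RHS]big_mkcond; apply: eq_bigr => i _.
  by case: ifP => // /negbT/bF.
rewrite (E a) // (E (fun i => a i ^+ 2)); last by move=> i /aF->; rewrite expr0n.
set S := \sum_(i | F i) a i ^+ 2.
set m := \sum_(i | F i) a i.
have H : \sum_(i | F i) \sum_(k | F k) (a i - a k) ^+ 2
         = 2 * (#|F|%:R * S - m ^+ 2).
  transitivity (\sum_(i | F i) (#|F|%:R * a i ^+ 2 - 2 * m * a i + S)).
    apply: eq_bigr => i _; under eq_bigr => k _ do rewrite sqrrB.
    rewrite big_split sumrB /= sumr_const -/S; congr (_ - _ + _).
      by rewrite mulr_natl.
    by rewrite sumrMnl -mulr_sumr -/m; ring.
  rewrite big_split sumrB /= -!mulr_sumr sumr_const -/S -/m -(mulr_natl S); ring.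
rewrite -subr_ge0 -(pmulr_rge0 _ (ltr0n _ 2)) -H.
by apply: sumr_ge0 => i _; apply: sumr_ge0 => k _; apply: sqr_ge0.
Qed.

(** * Moments of a uniform draw *)

Definition draw_weight (R : realFieldType) (T : finType) (A : {set T}) (k : nat)
    (B : {set T}) : R :=
  if B \in draws A k then #|draws A k|%:R^-1 else 0.

Section DrawMoments.
Context (R : realFieldType) (T : finType) (A : {set T}) (k : nat).
Hypothesis kA : (1 <= k <= #|A|)%N.
Implicit Types (B J : {set T}) (a : T -> R).

(** Taking [#|J| = 0, 1, 2] gives the total mass, the probability of an element
    and the joint probability of a pair. *)
Lemma draws_mean_superset J : J \subset A ->
  \sum_B draw_weight R A k B * (J \subset B)%:R
  = (k ^_ #|J|)%:R / (#|A| ^_ #|J|)%:R.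
Proof.
move=> JA; have /andP[_ lekA] := kA.
have bin0 : 'C(#|A|, k)%:R != 0 :> R by rewrite pnatr_eq0 -lt0n bin_gt0.
have ff0 : (#|A| ^_ #|J|)%:R != 0 :> R.
  by rewrite pnatr_eq0 -lt0n ffact_gt0 subset_leq_card.
apply: (mulfI ff0); rewrite mulrCA divff // mulr1.
transitivity ((#|A| ^_ #|J|)%:R
    * (#|[set B in draws A k | J \subset B]%SET|%:R / 'C(#|A|, k)%:R) : R).
  congr (_ * _); rewrite -sum1_card natr_sum mulr_suml [RHS]big_mkcond /=.
  apply: eq_bigr => B _; rewrite /draw_weight card_draws_set [in RHS]finset.in_set.
  case: (B \in draws A k) => /=; last by rewrite mul0r.
  by case: (J \subset B); rewrite ?mulr1 ?mulr0 ?mul1r.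
by rewrite mulrA -natrM card_draws_superset // natrM mulrAC divff // mul1r.
Qed.

Lemma draw_weight_sum1 : \sum_B draw_weight R A k B = 1.
Proof.
have := draws_mean_superset (finset.sub0set A).
rewrite cards0 !ffactn0 divr1 => sum_eq; rewrite -[RHS]sum_eq.
by apply: eq_bigr => B _; rewrite finset.sub0set mulr1.
Qed.

(** Summing over the fixed set [A] instead of the random [B] is what allows the
    order of summation to be exchanged. *)
Lemma draw_weight_sum_mem a B :
  draw_weight R A k B * \sum_(i in B) a i
  = draw_weight R A k B * \sum_(i in A) ([set i]%SET \subset B)%:R * a i.
Proof.
rewrite /draw_weight; case: ifP => [|_]; last by rewrite !mul0r.
rewrite !inE => /andP[BA _]; congr (_ * _).
rewrite big_mkcond [RHS]big_mkcond /=; apply: eq_bigr => i _.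
rewrite finset.sub1set; case: (boolP (i \in B)) => [/(fintype.subsetP BA) ->|_].
  by rewrite mul1r.
by rewrite mul0r if_same.
Qed.

Lemma draws_mean_sum a :
  \sum_B draw_weight R A k B * (\sum_(i in B) a i)
  = k%:R / #|A|%:R * \sum_(i in A) a i.
Proof.
under eq_bigr => B _ do rewrite draw_weight_sum_mem mulr_sumr.
rewrite exchange_big mulr_sumr; apply: eq_bigr => i iA /=.
under eq_bigr => B _ do rewrite mulrA.
by rewrite -mulr_suml draws_mean_superset ?finset.sub1set // cards1 !ffactn1.
Qed.

(** Off-diagonal pairs have joint probability [k (k - 1) / (#|A| (#|A| - 1))].
    When [#|A| = 1] there is no such pair and [k = 1], so that replacing
    [#|A| - 1] by [s1 #|A|] keeps the formula valid: [beta] is then [0]. *)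
Lemma draws_mean_sqr a (beta : R := (k%:R - 1) / (s1 #|A|)%:R) :
  \sum_B draw_weight R A k B * (\sum_(i in B) a i) ^+ 2
  = k%:R / #|A|%:R * ((1 - beta) * (\sum_(i in A) a i ^+ 2)
                      + beta * (\sum_(i in A) a i) ^+ 2).
Proof.
have /andP[k1 lekA] := kA.
transitivity (k%:R / #|A|%:R * (\sum_(i in A) a i ^+ 2)
    + \sum_(i in A) \sum_(j in A | j != i)
        (k%:R / #|A|%:R * beta) * (a i * a j) : R); last first.
  rewrite sum_sqr_pairs.
  rewrite [X in _ + X = _](_ : _ = k%:R / #|A|%:R * beta
      * \sum_(i in A) \sum_(j in A | j != i) a i * a j); first by ring.
  by rewrite mulr_sumr; apply: eq_bigr => i _; rewrite mulr_sumr.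
rewrite -draws_mean_sum.
transitivity (\sum_B (draw_weight R A k B * \sum_(i in B) a i ^+ 2
   + \sum_(i in A) \sum_(j in A | j != i)
       draw_weight R A k B * ([set i; j]%SET \subset B)%:R * (a i * a j)) : R).
  apply: eq_bigr => B _; rewrite sum_sqr_pairs mulrDr; congr (_ + _).
  rewrite /draw_weight; case: ifP => [|_]; last first.
    rewrite mul0r big1 // => i _; rewrite big1 // => j _; by rewrite !mul0r.
  rewrite !inE => /andP[/fintype.subsetP BA _].
  rewrite mulr_sumr big_mkcond [RHS]big_mkcond /=; apply: eq_bigr => i _.
  case: (boolP (i \in B)) => [iB|iB]; last first.
    case: ifP => // _; rewrite big1 // => j _.
    by rewrite finset.subUset finset.sub1set (negbTE iB) /= mulr0 mul0r.
  rewrite (BA _ iB) mulr_sumr big_mkcond [RHS]big_mkcond /=.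
  apply: eq_bigr => j _; rewrite finset.subUset !finset.sub1set iB /=.
  case: (boolP (j \in B)) => [/BA ->|_] /=; first by rewrite mulr1.
  by rewrite mulr0 mul0r if_same.
rewrite big_split; congr (_ + _); rewrite exchange_big; apply: eq_bigr => i iA.
rewrite exchange_big; apply: eq_bigr => j /andP[jA ji] /=.
rewrite -mulr_suml; congr (_ * _).
rewrite draws_mean_superset ?finset.subUset ?finset.sub1set ?iA //.
(* A pair of distinct elements exists, so [s1 #|A|] is [#|A| - 1]. *)
have A2 : (2 <= #|A|)%N.
  have /subset_leq_card : [set i; j]%SET \subset A
    by rewrite finset.subUset !finset.sub1set iA jA.
  by rewrite cards2 eq_sym ji.
rewrite cards2 eq_sym ji /= /beta /s1 (maxn_idPr _) ?subn_gt0 //.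
rewrite !ffactnSr !ffactn0 !mul1n !subn0 !natrM.
by rewrite (natrB _ k1) mulf_div.
Qed.

End DrawMoments.

(** * Product laws on a finite family *)

Definition prod_weight (R : realFieldType) (I U : finType) (q : I -> U -> R)
    (u : {ffun I -> U}) : R :=
  \prod_l q l (u l).

Section ProductMean.
Context (R : realFieldType) (I U : finType) (q : I -> U -> R).
Hypothesis q1 : forall l, \sum_B q l B = 1.

(** Distributivity of the product over the sum: this one identity encodes the
    independence of the coordinates, marginals and pairs being the cases where
    all but one or two of the [X l] are [1]. *)
Lemma prod_mean_prod (X : I -> U -> R) :
  \sum_u prod_weight q u * \prod_l X l (u l) = \prod_l \sum_B q l B * X l B.
Proof.
by rewrite bigA_distr_bigA; apply: eq_bigr => u _; rewrite big_split.
Qed.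

Lemma prod_mean_marginal l (X : U -> R) :
  \sum_u prod_weight q u * X (u l) = \sum_B q l B * X B.
Proof.
transitivity (\sum_u prod_weight q u
    * \prod_m (if m == l then X (u m) else 1)).
  by apply: eq_bigr => u _; rewrite -big_mkcond big_pred1_eq.
rewrite (prod_mean_prod (fun m B => if m == l then X B else 1)).
rewrite (bigD1 l) //= eqxx [X in _ * X]big1 ?mulr1 // => m /negbTE ->.
by under eq_bigr => B _ do rewrite mulr1; rewrite q1.
Qed.

Lemma prod_weight_sum1 : \sum_u prod_weight q u = 1.
Proof.
rewrite -(bigA_distr_bigA q) big1 // => l _; exact: q1.
Qed.

Lemma prod_mean_indep l m (X Y : U -> R) : l != m ->
  \sum_u prod_weight q u * (X (u l) * Y (u m))
  = (\sum_B q l B * X B) * (\sum_B q m B * Y B).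
Proof.
move=> lm.
pose Z p B := if p == l then X B else if p == m then Y B else 1.
transitivity (\sum_u prod_weight q u * \prod_p Z p (u p)).
  apply: eq_bigr => u _; congr (_ * _).
  rewrite (bigD1 l) //= (bigD1 m) //=; last by rewrite eq_sym.
  rewrite big1 /Z ?eqxx; last by move=> p /andP[/negbTE -> /negbTE ->].
  by rewrite eq_sym (negbTE lm) mulr1.
rewrite prod_mean_prod (bigD1 l) //= (bigD1 m) //=; last by rewrite eq_sym.
rewrite [X in _ * (_ * X)]big1 /Z ?eqxx; last first.
  move=> p /andP[/negbTE -> /negbTE ->].
  by under eq_bigr => B _ do rewrite mulr1; rewrite q1.
by rewrite eq_sym (negbTE lm) mulr1.
Qed.

(** The second moment of a sum of independent terms: the diagonal keeps its
    second moments, each cross term becomes a product of means. *)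
Lemma prod_mean_sqr_sum (X : I -> U -> R) (mu := fun l => \sum_B q l B * X l B) :
  \sum_u prod_weight q u * (\sum_l X l (u l)) ^+ 2
  = \sum_l (\sum_B q l B * X l B ^+ 2)
    + ((\sum_l mu l) ^+ 2 - \sum_l mu l ^+ 2).
Proof.
rewrite sum_sqr_pairs [X in _ + X]addrC addKr /=.
under eq_bigr => u _ do rewrite sum_sqr_pairs mulrDr !mulr_sumr /=.
rewrite big_split /=; congr (_ + _); rewrite exchange_big /=; apply: eq_bigr => l _.
  by rewrite (prod_mean_marginal l (fun B => X l B ^+ 2)).
under eq_bigr => u _ do rewrite mulr_sumr.
rewrite exchange_big /=; apply: eq_bigr => m ml.
by rewrite (prod_mean_indep (X l) (X m)) // eq_sym.
Qed.

End ProductMean.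

(** * Expectations of finitely-valued random elements *)

Section FiniteExpectation.
Context (R : realType) (dsp : measure_display) (T : measurableType dsp)
  (P : probability T R).

(** [g (X w)] is the combination, with coefficients [g u], of the indicators of
    the fibres of [X], which are finitely many and measurable. *)
Lemma expectation_random_element (U : finType) (X : T -> U) (g : U -> R) :
  random_element X ->
  ('E_P[fun w => g (X w)]
   = \sum_u (g u)%:E * P (X @^-1` [set u])%classic)%E.
Proof.
move=> mX; rewrite unlock.
transitivity (\int[P]_w \sum_u ((g u)%:E * (\1_(X @^-1` [set u]) w)%:E))%E.
  apply: eq_integral => w _.
  rewrite (bigD1 (X w)) //= big1 ?adde0; last first.
    move=> u uX; rewrite indicE memNset ?mule0 //= => XE.
    by rewrite XE eqxx in uX.
  by rewrite indicE mem_set // mule1.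
rewrite integral_sum //; last first.
  by move=> u; apply: integrableZl => //; exact: integrable_indic.
apply: eq_bigr => u _; rewrite integralZl //; last exact: integrable_indic.
by rewrite integral_indic // setIT.
Qed.

Lemma preimage_ffun (I U : finType) (X : I -> T -> U) (u : {ffun I -> U}) :
  ((fun w => [ffun i => X i w]) @^-1` [set u]
   = \bigcap_(i in [set` [set: I]%SET]) X i @^-1` [set u i])%classic.
Proof.
apply/seteqP; split => w /= Xw.
  by move=> i _ /=; rewrite -Xw ffunE.
by apply/ffunP => i; rewrite ffunE; apply: Xw => //=; rewrite inE.
Qed.

Lemma random_element_ffun (I U : finType) (X : I -> T -> U) :
  (forall i, random_element (X i)) ->
  random_element (fun w => [ffun i => X i w]).
Proof.
move=> mX u; rewrite preimage_ffun.
by apply: fin_bigcap_measurable => // i _; exact: mX.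
Qed.

(** Gathering the family into one [{ffun I -> U}]-valued element makes its law
    a product, by independence applied to the fibres. *)
Lemma expectation_independent (I U : finType) (X : I -> T -> U)
    (q : I -> U -> R) (g : {ffun I -> U} -> R) :
  (forall i, random_element (X i)) ->
  (forall i u, P (X i @^-1` [set u])%classic = (q i u)%:E) ->
  mutually_independent P X ->
  ('E_P[fun w => g [ffun i => X i w]] = (\sum_u prod_weight q u * g u)%:E)%E.
Proof.
move=> mX qX indep.
rewrite (expectation_random_element g (random_element_ffun mX)).
rewrite -sumEFin; apply: eq_bigr => u _; rewrite mulrC EFinM; congr (_ * _)%E.
rewrite preimage_ffun (indep _ (fun i => [set u i]%classic)).
rewrite /prod_weight -prodEFin; apply: eq_big => [i|i _]; first by rewrite inE.
exact: qX.
Qed.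

End FiniteExpectation.

(** * Moments of a sum over the sampled coordinates *)

Section BlockSampling.
Context (R : realType) (d c s tau : nat) (Q : 'I_c -> {set 'I_d}).
Hypotheses (eqQ : equipartition s Q) (tau_le : (1 <= tau <= s)%N).
Implicit Types (a : 'I_d -> R) (u : {ffun 'I_c -> {set 'I_d}}).

Let card_block l : #|Q l| = s. Proof. by case: eqQ. Qed.

Lemma blocks_disjoint l m : l != m -> [disjoint Q l & Q m].
Proof.
case: eqQ => injQ /and3P[_ /finset.trivIsetP tQ _] _ lm.
by apply: tQ; rewrite ?imset_f // (inj_eq injQ).
Qed.

Lemma blocks_cover : (\bigcup_l Q l)%SET = [set: 'I_d]%SET.
Proof.
case: eqQ => _ /and3P[/eqP <- _ _] _; rewrite /finset.cover big_imset //=.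
by move=> l m _ _; case: eqQ => injQ _ _; apply: injQ.
Qed.

Lemma sum_blocks a : \sum_i a i = \sum_l \sum_(i in Q l) a i.
Proof.
rewrite -(partition_disjoint_bigcup _ a blocks_disjoint) blocks_cover.
by apply: eq_bigl => i; rewrite inE.
Qed.

Let q l := draw_weight R (Q l) tau.

Let q1 l : \sum_B q l B = 1.
Proof. by apply: draw_weight_sum1; rewrite card_block. Qed.

Lemma prod_weight_support u :
  prod_weight q u != 0 -> forall l, u l \in draws (Q l) tau.
Proof.
move=> + l; rewrite /prod_weight (bigD1 l) //= mulf_eq0 negb_or => /andP[+ _].
by rewrite /q /draw_weight; case: ifP; rewrite ?eqxx.
Qed.

(** Draws from distinct blocks are disjoint, so the sum over their union splits;
    the families that are not draws have weight [0].  The function [phi] serves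
    the first moment ([id]) and the second one (the square). *)
Lemma sampled_sum (phi : R -> R) a u :
  prod_weight q u * phi (\sum_(i in (\bigcup_l u l)%SET) a i)
  = prod_weight q u * phi (\sum_l \sum_(i in u l) a i).
Proof.
have [->|/prod_weight_support uQ] := eqVneq (prod_weight q u) 0.
  by rewrite !mul0r.
have sub l : u l \subset Q l by have := uQ l; rewrite !inE => /andP[].
congr (_ * phi _); apply: partition_disjoint_bigcup => l m /blocks_disjoint.
move=> dQ; apply: (disjointWl (sub l)); exact: disjointWr (sub m) dQ.
Qed.

Lemma sampling_mean_sum a :
  \sum_u prod_weight q u * (\sum_(i in (\bigcup_l u l)%SET) a i)
  = tau%:R / s%:R * \sum_i a i.
Proof.
under eq_bigr => u _ do rewrite (sampled_sum id) mulr_sumr.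
rewrite exchange_big sum_blocks mulr_sumr; apply: eq_bigr => l _ /=.
rewrite (prod_mean_marginal q1 l (fun B => \sum_(i in B) a i)).
by rewrite draws_mean_sum ?card_block.
Qed.

(** The exact second moment, arranged so that the pairs of distinct blocks, of
    joint probability [(tau/s)^2], show up as an excess of [tau/s - beta] over
    the pairs inside a block. *)
Lemma sampling_mean_sqr a (beta : R := (tau%:R - 1) / (s1 s)%:R)
    (b := fun l => \sum_(i in Q l) a i) :
  \sum_u prod_weight q u * (\sum_(i in (\bigcup_l u l)%SET) a i) ^+ 2
  = tau%:R / s%:R
    * ((1 - beta) * (\sum_i a i ^+ 2) + beta * (\sum_i a i) ^+ 2
       + (tau%:R / s%:R - beta) * ((\sum_i a i) ^+ 2 - \sum_l b l ^+ 2)).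
Proof.
under eq_bigr => u _ do rewrite (sampled_sum (fun x => x ^+ 2)).
rewrite (prod_mean_sqr_sum q1 (fun l B => \sum_(i in B) a i)).
under eq_bigr => l _ do rewrite draws_mean_sqr ?card_block //.
under [\sum_l (\sum_B _)]eq_bigr => l _ do rewrite draws_mean_sum ?card_block //.
under [\sum_l (\sum_B _) ^+ 2]eq_bigr => l _
  do rewrite draws_mean_sum ?card_block // exprMn.
rewrite -!mulr_sumr big_split /= -!mulr_sumr.
rewrite -!sum_blocks -/b -/beta.
ring.
Qed.

(** Drawing without replacement cannot make two elements of one block positively
    correlated.  After the denominators are cleared, and since [s - 1 <= s1 s],
    it is enough that [(tau - 1) s <= tau (s - 1)], that is [tau <= s]. *)
Lemma draw_gap_ge0 : 0 <= tau%:R / s%:R - (tau%:R - 1) / (s1 s)%:R :> R.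
Proof.
have /andP[t1 ts] := tau_le; have s_gt0 := leq_trans t1 ts.
have s1_gt0 : (0 < s1 s)%N by rewrite /s1 leq_max.
rewrite subr_ge0 ler_pdivrMr ?ltr0n // mulrAC ler_pdivlMr ?ltr0n //.
have -> : tau%:R - 1 = (tau - 1)%:R :> R by rewrite natrB.
rewrite -!natrM ler_nat mulnBl mul1n.
apply: (@leq_trans (tau * (s - 1))).
  by rewrite mulnBr muln1 leq_sub2l.
by rewrite leq_mul2l /s1 leq_maxr orbT.
Qed.

End BlockSampling.

(** * The bound on the contribution of one row *)

Section RowBound.
Context (R : realType) (n d c s tau : nat) (A : 'M[R]_(n, d))
  (Q : 'I_c -> {set 'I_d}).
Hypotheses (eqQ : equipartition s Q) (tau_le : (1 <= tau <= s)%N).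
Variables (j : 'I_n).
Hypothesis Aj : row j A != 0.

Let exA : exists i, A j i != 0.
Proof.
apply/existsP; apply: contraNT Aj; rewrite negb_exists => /forallP A0.
by apply/eqP/rowP => i; rewrite !mxE; apply/eqP; rewrite -[_ == _]negbK A0.
Qed.

Lemma omega_gt0 : (0 < omega A j)%N.
Proof. by have [i Ai] := exA; apply/card_gt0P; exists i. Qed.

Lemma omega'_gt0 : (0 < omega' A Q j)%N.
Proof.
have [i Ai] := exA; have : i \in (\bigcup_l Q l)%SET.
  by rewrite (blocks_cover eqQ) inE.
move=> /finset.bigcupP[l _ il]; apply/card_gt0P; exists l.
by rewrite inE; apply/finset.set0Pn; exists i; rewrite inE il.
Qed.

Let beta : R := (tau%:R - 1) / (s1 s)%:R.

Let beta_ge0 : 0 <= beta.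
Proof.
have /andP[t1 _] := tau_le.
by rewrite /beta divr_ge0 // subr_ge0 ler1n.
Qed.

Let alphaE : alpha s tau A Q j = 1 + (beta * ((omega A j)%:R - 1)
  + (tau%:R / s%:R - beta)
    * (((omega' A Q j)%:R - 1) / (omega' A Q j)%:R * (omega A j)%:R)).
Proof. by rewrite /alpha /alpha1 /alpha2 /beta; ring. Qed.

Lemma alpha_gt0 : 0 < alpha s tau A Q j.
Proof.
have w1 : 1 <= (omega A j)%:R :> R by rewrite ler1n omega_gt0.
have w'1 : 1 <= (omega' A Q j)%:R :> R by rewrite ler1n omega'_gt0.
have gap_ge0 : beta <= tau%:R / s%:R by rewrite -subr_ge0 draw_gap_ge0.
rewrite alphaE ltr_pwDl // addr_ge0 //.
  by rewrite mulr_ge0 // subr_ge0.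
by rewrite !mulr_ge0 ?subr_ge0 ?invr_ge0 ?ler0n.
Qed.

Lemma sampling_row_mean_sqr (h : 'I_d -> R) (a := fun i => A j i * h i) :
  \sum_u prod_weight (fun l => draw_weight R (Q l) tau) u
    * (\sum_(i in (\bigcup_l u l)%SET) a i) ^+ 2
  <= tau%:R / s%:R * (alpha s tau A Q j * \sum_i a i ^+ 2).
Proof.
rewrite (sampling_mean_sqr eqQ tau_le) -/beta ler_wpM2l ?divr_ge0 ?ler0n //.
set b := fun l => \sum_(i in Q l) a i.
have leV : (\sum_i a i) ^+ 2 <= (omega A j)%:R * \sum_i a i ^+ 2.
  apply: sqr_sum_le_card => i /=.
  by rewrite negbK /a => /eqP ->; rewrite mul0r.
have leB : (\sum_i a i) ^+ 2 <= (omega' A Q j)%:R * \sum_l b l ^+ 2.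
  rewrite (sum_blocks eqQ); apply: sqr_sum_le_card => l /=.
  rewrite negbK => /eqP Ql0; rewrite big1 // => i il.
  have := finset.in_set0 i; rewrite -Ql0 inE il /= => /negbT.
  by rewrite negbK /a => /eqP ->; rewrite mul0r.
have w'_gt0 : 0 < (omega' A Q j)%:R :> R by rewrite ltr0n omega'_gt0.
have w'1 : 1 <= (omega' A Q j)%:R :> R by rewrite ler1n omega'_gt0.
set V := \sum_i a i ^+ 2 in leV *.
set B2 := \sum_l b l ^+ 2 in leB *.
set T2 := (\sum_i a i) ^+ 2 in leV leB *.
(* [B2 >= T2 / omega'], then [T2 <= omega V]. *)
have gap : T2 - B2 <= ((omega' A Q j)%:R - 1) / (omega' A Q j)%:R
                       * (omega A j)%:R * V.
  apply: (@le_trans _ _ (((omega' A Q j)%:R - 1) / (omega' A Q j)%:R * T2)).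
    rewrite mulrBl divff ?gt_eqF // mul1r mulrBl mul1r lerD2l lerN2.
    by rewrite mulrC ler_pdivrMr // mulrC.
  by rewrite -[leRHS]mulrA ler_wpM2l // divr_ge0 ?subr_ge0 // ltW.
apply: (@le_trans _ _ ((1 - beta) * V + beta * ((omega A j)%:R * V)
   + (tau%:R / s%:R - beta) * (((omega' A Q j)%:R - 1) / (omega' A Q j)%:R
                       * (omega A j)%:R * V))).
  rewrite lerD ?lerD2l ?ler_wpM2l //; exact: (draw_gap_ge0 R tau_le).
by rewrite alphaE le_eqVlt; apply/orP; left; apply/eqP; ring.
Qed.

End RowBound.

(** * From second moments to the overapproximation *)

Section QuadraticForms.
Context (R : realType) (d : nat).
Implicit Types (h : 'cV[R]_d) (S : {set 'I_d}).

Lemma mulmx_restrict_coord m (M : 'M[R]_(m, d)) h S j :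
  (M *m restrict_coord h S) j 0 = \sum_(i in S) M j i * h i 0.
Proof.
rewrite /restrict_coord mulmx_sumr summxE; apply: eq_bigr => i _.
by rewrite -scalemxAr -colE !mxE mulrC.
Qed.

Lemma gram_form m (M : 'M[R]_(m, d)) h :
  (h^T *m M^T *m M *m h) 0 0 = \sum_j (M *m h) j 0 ^+ 2.
Proof.
rewrite -mulmxA -trmx_mul mxE; apply: eq_bigr => j _.
by rewrite mxE expr2.
Qed.

Lemma diag_form (v : 'rV[R]_d) h :
  (h^T *m diag_mx v *m h) 0 0 = \sum_i v 0 i * h i 0 ^+ 2.
Proof.
rewrite mxE; apply: eq_bigr => i _.
by rewrite mul_mx_diag !mxE mulrAC -expr2 mulrC.
Qed.

End QuadraticForms.

(** The samples being uniform on the draws, their laws are literally the weights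
    [draw_weight]. *)
Lemma expectation_distributed (R : realType) (dsp : measure_display)
    (T : measurableType dsp) (P : probability T R) (d c tau : nat)
    (Q : 'I_c -> {set 'I_d}) (Shat : T -> {set 'I_d}) (g : {set 'I_d} -> R) :
  distributed_sampling P tau Q Shat ->
  ('E_P[fun w => g (Shat w)]
   = (\sum_u prod_weight (fun l => draw_weight R (Q l) tau) u
        * g (\bigcup_l u l)%SET)%:E)%E.
Proof.
move=> [S [mS unifS indepS ShatE]].
rewrite -(expectation_independent (fun u => g (\bigcup_l u l)%SET)
  mS unifS indepS).
congr expectation; apply/funext => w; rewrite ShatE; congr g.
by apply: eq_bigr => l _; rewrite ffunE.
Qed.

Theorem theorem2 (R : realType) (n d c s tau : nat) (A : 'M[R]_(n, d))
    (Q : 'I_c -> {set 'I_d}) (f : 'cV[R]_d -> R)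
    (dsp : measure_display) (T : measurableType dsp) (P : probability T R)
    (Shat : T -> {set 'I_d}) :
  (forall j : 'I_n, row j A != 0) ->
  (forall i : 'I_d, col i A != 0) ->
  equipartition s Q ->
  (1 <= tau <= s)%N ->
  convex_differentiable f ->
  quadratic_upper_bound f A ->
  distributed_sampling P tau Q Shat ->
  ESO P f Shat (eso_matrix s tau A Q).
Proof.
move=> rowA colA eqQ tau_le _ fA sampS; split.
- exact: diag_mx_is_diag.
- move=> i; rewrite !mxE eqxx mulr1n.
  have [j Aji] : exists j, A j i != 0.
    apply/existsP; apply: contraNT (colA i); rewrite negb_exists => /forallP A0.
    by apply/eqP/colP => j; rewrite !mxE; apply/eqP; rewrite -[_ == _]negbK A0.
  rewrite (bigD1 j) //= ltr_pwDl //.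
    by rewrite mulr_gt0 ?(alpha_gt0 eqQ tau_le) // exprn_even_gt0.
  apply: sumr_ge0 => k _; apply: mulr_ge0; last exact: sqr_ge0.
  by rewrite ltW ?(alpha_gt0 eqQ tau_le).
move=> x h.
set G := ((gradient f x)^T *m h) 0 0.
rewrite (expectation_distributed (fun B => f (x + restrict_coord h B)) sampS).
rewrite (expectation_distributed (fun B => #|B|%:R) sampS).
under [X in (_ + X%:E * _ * _)%E]eq_bigr => u _ do rewrite -sum1_card natr_sum.
rewrite (sampling_mean_sum eqQ tau_le (fun=> 1)).
rewrite -!EFinM -EFinD lee_fin sumr_const card_ord diag_form.
set p : R := tau%:R / s%:R.
set W := prod_weight _.
have W_ge0 u : 0 <= W u.
  apply: prodr_ge0 => l _; rewrite /draw_weight; by case: ifP.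
have W1 : \sum_u W u = 1.
  apply: prod_weight_sum1 => l; apply: draw_weight_sum1.
  by case: eqQ => _ _ ->.
(* [#|Shat w|] is the sum of the constant [1] over the sample, whence its mean
   [p * d%:R]. *)
pose a j i := A j i * h i 0.
apply: (@le_trans _ _ (\sum_u W u * (f x
    + \sum_(i in (\bigcup_l u l)%SET) (gradient f x) i 0 * h i 0
    + 2^-1 * \sum_j (\sum_(i in (\bigcup_l u l)%SET) a j i) ^+ 2))).
  apply: ler_sum => u _; apply: ler_wpM2l => //.
  apply: le_trans (fA _ _) _; rewrite mulmx_restrict_coord gram_form.
  rewrite le_eqVlt; apply/orP; left; apply/eqP; congr (_ + _ + _ * _).
    by apply: eq_bigr => i _; rewrite mxE.
  by apply: eq_bigr => j _; rewrite mulmx_restrict_coord.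
have -> : p * d%:R * d%:R^-1 * (G + 2^-1 * \sum_i
    (\row_i0 \sum_(j < n) alpha s tau A Q j * A j i0 ^+ 2) 0 i * h i 0 ^+ 2)
  = p * G + 2^-1 * \sum_j p * (alpha s tau A Q j * \sum_i a j i ^+ 2).
  have -> : \sum_i (\row_i0 \sum_(j < n) alpha s tau A Q j * A j i0 ^+ 2) 0 i
        * h i 0 ^+ 2 = \sum_j (alpha s tau A Q j * \sum_i a j i ^+ 2).
    under eq_bigr => i _ do rewrite mxE mulr_suml.
    rewrite exchange_big; apply: eq_bigr => j _; rewrite mulr_sumr.
    by apply: eq_bigr => i _; rewrite /a; ring.
  rewrite -mulr_sumr.
  (* For [d = 0] the factor [d%:R^-1] is [0] and does not cancel, but then the
     bracket is an empty sum. *)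
  have [d0|d_gt0] := posnP d; last first.
    by rewrite mulfK ?pnatr_eq0 -?lt0n //; ring.
  have I0 (b : 'I_d -> R) : \sum_i b i = 0.
    by apply: big1 => i; have := ltn_ord i; rewrite {2}d0.
  rewrite /G mxE I0 [\sum_j _]big1 ?mulr0 ?addr0 ?mulr0 // => j _.
  by rewrite I0 mulr0.
under eq_bigr => u _ do rewrite !mulrDr.
rewrite !big_split /= -mulr_suml W1 mul1r -addrA lerD2l lerD //.
  rewrite (sampling_mean_sum eqQ tau_le).
  rewrite le_eqVlt; apply/orP; left; apply/eqP; congr (_ * _).
  by rewrite /G mxE; apply: eq_bigr => i _; rewrite [in RHS]mxE.
under eq_bigr => u _ do rewrite mulrCA mulr_sumr.
rewrite -mulr_sumr ler_wpM2l ?invr_ge0 ?ler0n // exchange_big /=.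
by apply: ler_sum => j _; apply: sampling_row_mean_sqr.
Qed.
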